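(* Let $t\in[n]$ and let $S\subseteq N$ be a maximal $t$-switchable set. Then $P^{\langle t\rangle}_S$ is a minimal associated prime ideal of $\mathcal{I}^{\langle t\rangle}$.
   Context: Fix positive integers $n, r_1,\dots,r_n$, let $N=[r_1]\times\cdots\times[r_n]$, and let $R$ be the polynomial ring over a field in the variables $x_a$, $a\in N$. For $a,b\in N$ and $i\in[n]$, ${\rm s}(i,a,b)\in N$ has $i$-th component $b_i$ and other components equal to those of $a$. Let $d(a,b)=\#\{j: a_j\neq b_j\}$ and $f_{i,a,b}=x_ax_b-x_{{\rm s}(i,a,b)}x_{{\rm s}(i,b,a)}$. Let $\mathcal{I}^{\langle t\rangle}=(f_{i,a,b}: a,b\in N,\ d(a,b)=2,\ i\in[t])$. A subset $S\subseteq N$ is $t$-switchable if for all $a,b\in S$ with $d(a,b)=2$ and all $i\in[t]$, ${\rm s}(i,a,b)\in S$. Elements $a,b\in S$ are connected in $S$ if there are $a_0=a,\dots,a_k=b$ in $S$ with $d(a_{j-1},a_j)\le 1$ for all $j$. For $t$-switchable $S$: $\tilde{\mathcal{I}}^{\langle t\rangle}_S=(f_{i,a,b}: i\in[t],\ a,b \text{ connected in } S)$, $\mathrm{Var}^{\langle t\rangle}_S=(x_a: a\notin S)$, $P^{\langle t\rangle}_S=\mathrm{Var}^{\langle t\rangle}_S+\tilde{\mathcal{I}}^{\langle t\rangle}_S$. A $t$-switchable $S$ is maximal $t$-switchable if for every $t$-switchable $T$ properly containing $S$, $P^{\langle t\rangle}_S$ and $P^{\langle t\rangle}_T$ are incomparable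 under inclusion. *)

(* Defs.v *)
From HB Require Import structures.
From mathcomp Require Import all_boot all_order all_algebra.
From mathcomp Require Import mpoly.
Set Implicit Arguments. Unset Strict Implicit. Unset Printing Implicit Defensive.
Import GRing.Theory.
Local Open Scope ring_scope.

Section Defs.
Variables (F : fieldType) (n : nat) (r : 'I_n -> nat).

Definition grid := {dffun forall i : 'I_n, 'I_(r i)}.

Definition polyR := {mpoly F[#|{: grid}|]}.
Definition xvar (a : grid) : polyR := 'X_(enum_rank a).

Definition sw (i : 'I_n) (a b : grid) : grid :=
  [ffun j => if j == i then b j else a j].

Definition dist (a b : grid) : nat := #|[pred j | a j != b j]|.

Definition fgen (i : 'I_n) (a b : grid) : polyR :=
  xvar a * xvar b - xvar (sw i a b) * xvar (sw i b a).

Definition ideal_gen (G : polyR -> Prop) : polyR -> Prop :=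
  fun f => exists s : seq (polyR * polyR),
      (forall p, p \in s -> G p.2) /\ f = \sum_(p <- s) p.1 * p.2.

Definition subI (I J : polyR -> Prop) := forall f, I f -> J f.
Definition eqI (I J : polyR -> Prop) := forall f, I f <-> J f.

Definition is_ideal (I : polyR -> Prop) :=
  I 0 /\ (forall f g, I f -> I g -> I (f + g)) /\ (forall c f, I f -> I (c * f)).

Definition prime_ideal (P : polyR -> Prop) :=
  is_ideal P /\ ~ P 1 /\ (forall f g, P (f * g) -> P f \/ P g).

Definition assoc_prime (I P : polyR -> Prop) :=
  prime_ideal P /\ exists f : polyR, forall g, P g <-> I (g * f).

Definition min_assoc_prime (I P : polyR -> Prop) :=
  assoc_prime I P /\
  forall Q, assoc_prime I Q -> subI Q P -> eqI Q P.

(* Index i in [t] corresponds to 0-based i : 'I_n with i < t. *)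
Definition It (t : nat) : polyR -> Prop :=
  ideal_gen (fun f => exists (i : 'I_n) (a b : grid),
                 [/\ dist a b = 2, (i < t)%N & f = fgen i a b]).

Definition switchable (t : nat) (S : {set grid}) :=
  forall a b, a \in S -> b \in S -> dist a b = 2 ->
  forall i : 'I_n, (i < t)%N -> sw i a b \in S.

Definition connectedIn (S : {set grid}) (a b : grid) :=
  [&& a \in S, b \in S &
      connect [rel u v | [&& u \in S, v \in S & (dist u v <= 1)%N]] a b].

Definition gensP (t : nat) (S : {set grid}) (f : polyR) : Prop :=
  (exists a, a \notin S /\ f = xvar a) \/
  (exists (i : 'I_n) (a b : grid),
      [/\ (i < t)%N, connectedIn S a b & f = fgen i a b]).

Definition PS (t : nat) (S : {set grid}) : polyR -> Prop := ideal_gen (gensP t S).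

Definition max_switchable (t : nat) (S : {set grid}) :=
  switchable t S /\
  forall T : {set grid}, switchable t T -> S \proper T ->
    ~ subI (PS t S) (PS t T) /\ ~ subI (PS t T) (PS t S).

End Defs.

(* Main.v *)
(* P_S is the kernel of the monomial map killing x_a for a outside S and sending
   the other x_a to a product of independent variables recording the component
   of a and its factors in the product decomposition of that component; two
   monomials with the same image are linked by switches, hence P_S is prime.
   For minimality, along a path in T one moves from row to row, so that
   f_{i,a,b} becomes a member of I^<t> after multiplication by a power of
   X_T = prod_{c in T} x_c.  If T contains S strictly, then s X_T^k lies in
   I^<t> for some s outside P_S: either T is not switchable, and
   x_a x_b = x_{s(i,a,b)} x_{s(i,b,a)} mod I^<t> reduces to a larger T, or T is
   switchable, and by maximality of S some generator f_{i,a,b} of P_T outside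
   P_S serves as s.  With T = S + {a} this makes x_a nilpotent modulo I^<t>
   locally at P_S.  So P_S is minimal over I^<t>, and a minimal prime with
   finitely many generators is a colon ideal. *)
Require Import Defs.
From mathcomp Require Import all_boot all_order all_algebra.
From mathcomp Require Import mpoly ring.
From Stdlib Require Import Classical.

Set Implicit Arguments. Unset Strict Implicit. Unset Printing Implicit Defensive.
Import GRing.Theory.
Local Open Scope ring_scope.

(** * Ideals, and primes that are colon ideals *)

Section Ideals.
Variables (F : fieldType) (n : nat) (r : 'I_n -> nat).
Implicit Types (I P Q G : polyR F r -> Prop) (f g h u s : polyR F r).

Lemma ideal_gen_ideal G : is_ideal (ideal_gen G).
Proof.
split; first by exists [::]; rewrite big_nil.
split=> [f g [s1 [h1 ->]] [s2 [h2 ->]]|c f [s [hs ->]]].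
  by exists (s1 ++ s2); rewrite big_cat; split=> // p; rewrite mem_cat => /orP[/h1|/h2].
exists [seq (c * p.1, p.2) | p <- s]; split=> [p /mapP[q /hs hq ->] //|].
by rewrite big_map mulr_sumr; apply: eq_bigr => p _; rewrite mulrA.
Qed.

Lemma mem_ideal_gen G f : G f -> ideal_gen G f.
Proof.
move=> Gf; exists [:: (1, f)]; rewrite big_seq1 mul1r; split=> // p.
by rewrite inE => /eqP->.
Qed.

Lemma ideal_sum I (T : eqType) (l : seq T) (A : pred T) (E : T -> polyR F r) :
  is_ideal I -> (forall x, x \in l -> A x -> I (E x)) -> I (\sum_(x <- l | A x) E x).
Proof.
move=> [I0 [ID _]] hE; rewrite big_seq_cond.
by apply: (big_ind I) => // x /andP[]; apply: hE.
Qed.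

Lemma ideal_gen_sub G I :
  is_ideal I -> (forall f, G f -> I f) -> subI (ideal_gen G) I.
Proof.
move=> idI GI f [s [hs ->]]; apply: ideal_sum => // p /hs Gp _.
by case: idI => _ [_ IM]; apply/IM/GI.
Qed.

Lemma idealMr I f g : is_ideal I -> I f -> I (f * g).
Proof. by move=> [_ [_ IM]] If; rewrite mulrC; apply: IM. Qed.

Lemma idealB I f g : is_ideal I -> I f -> I g -> I (f - g).
Proof. by move=> [_ [ID IM]] If Ig; apply: ID => //; rewrite -mulN1r; apply: IM. Qed.

Lemma ideal_trans I f g h : is_ideal I -> I (f - g) -> I (g - h) -> I (f - h).
Proof. by move=> [_ [ID _]] fg gh; rewrite -[f](subrK g) -addrA; apply: ID. Qed.

Lemma prime_idealX P f k : prime_ideal P -> P (f ^+ k) -> P f.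
Proof.
move=> [_ [P1 PM]]; elim: k => [/P1 //|k IH].
by rewrite exprS => /PM[].
Qed.

(** Descend to the least [k] for which some [s] outside [P] has [s * g ^+ k * h] in [I]; then
    [h' = s * g ^+ k.-1] works. Indeed, if [u * (h' * h)] lay in [I] with [u] outside [P], then
    [u * s] would do for a smaller exponent. The exponent 0 is excluded by the assumption on [h]. *)
Lemma colon_step I P g h k s :
  is_ideal I -> prime_ideal P -> (forall u, I (u * h) -> P u) ->
  ~ P s -> I (s * g ^+ k * h) ->
  exists h', (forall u, I (u * (h' * h)) -> P u) /\ I (g * (h' * h)).
Proof.
move=> idI [idP [P1 PM]] hP; elim: k s => [|k IH] s nPs Is.
  by case: nPs; apply: hP; rewrite expr0 mulr1 in Is.
have [[s' [nPs' Is']]|noex] := classic (exists s', ~ P s' /\ I (s' * g ^+ k * h)).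
  exact: IH Is'.
exists (s * g ^+ k); split=> [u Iu|]; last first.
  by rewrite mulrA (mulrC g) -(mulrA s) -exprSr.
apply: NNPP => nPu; apply: noex; exists (u * s); split; first by move=> /PM[].
by rewrite -!mulrA in Iu *.
Qed.

(* The element h is built by multiplying, one generator g at a time, by the last
   s * g ^+ k that does not yet kill the product locally at P. *)
Lemma prime_is_colon I P (l : seq (polyR F r)) :
  is_ideal I -> subI I P -> prime_ideal P ->
  subI P (ideal_gen (fun g => g \in l)) ->
  (forall g, g \in l -> exists k s, ~ P s /\ I (s * g ^+ k)) ->
  exists h, forall f, P f <-> I (f * h).
Proof.
move=> idI IP prP Pl hl.
suff [h [hP hI]] : exists h, (forall u, I (u * h) -> P u) /\ forall g, g \in l -> I (g * h).
  exists h => f; split=> [/Pl|/hP //].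
  apply: (@ideal_gen_sub _ (fun f => I (f * h))) => {f} //.
  case: idI => [I0 [ID IM]]; split; first by rewrite mul0r.
  split=> [f g If Ig|c f If]; first by rewrite mulrDl; apply: ID.
  by rewrite -mulrA; apply: IM.
elim: l hl {Pl} => [_|g l IH hl].
  by exists 1; split=> // u; rewrite mulr1; apply: IP.
have [|h [hP hI]] := IH; first by move=> f fl; apply: hl; rewrite inE fl orbT.
have [k [s [nPs Is]]] := hl g (mem_head _ _).
have [h' [h'P h'I]] := colon_step idI prP hP nPs (idealMr h idI Is).
exists (h' * h); split=> // f; rewrite inE => /predU1P[-> //|fl].
by rewrite mulrCA; case: idI => _ [_ IM]; apply/IM/hI.
Qed.

End Ideals.

(** * Monomial maps and their kernels *)

Section MonomialMap.
Variables (F : fieldType) (n : nat) (r : 'I_n -> nat) (S : {set grid r}).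
Variables (M : nat) (mon : grid r -> 'X_{1..M}).
Implicit Types (l : seq (grid r)) (m : 'X_{1..#|{: grid r}|}).

Definition xprod l : polyR F r := \prod_(a <- l) xvar F a.

Definition monmap (f : polyR F r) : {mpoly F[M]} :=
  mmap (@mpolyC M F)
    (fun i => if enum_val i \in S then 'X_[mon (enum_val i)] else 0) f.

Lemma monmap0 : monmap 0 = 0. Proof. exact: raddf0. Qed.
Lemma monmap1 : monmap 1 = 1. Proof. exact: rmorph1. Qed.
Lemma monmapD f g : monmap (f + g) = monmap f + monmap g.
Proof. exact: raddfD. Qed.
Lemma monmapB f g : monmap (f - g) = monmap f - monmap g.
Proof. exact: raddfB. Qed.
Lemma monmapM f g : monmap (f * g) = monmap f * monmap g.
Proof. exact: rmorphM. Qed.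
Lemma monmapZ c f : monmap (c *: f) = c *: monmap f.
Proof. by rewrite /monmap mmapZ /= mul_mpolyC. Qed.

Lemma monmap_var a : monmap (xvar F a) = if a \in S then 'X_[mon a] else 0.
Proof. by rewrite /monmap /xvar mmapX mmap1U enum_rankK. Qed.

Lemma monmap_xprod l :
  all (mem S) l -> monmap (xprod l) = 'X_[(\sum_(a <- l) mon a)%MM].
Proof.
rewrite /xprod; elim: l => [|a l IH] /=; first by rewrite !big_nil monmap1 mpolyX0.
by case/andP=> aS lS; rewrite !big_cons monmapM monmap_var aS IH // mpolyXD.
Qed.

Lemma monmap_xprod0 l : ~~ all (mem S) l -> monmap (xprod l) = 0.
Proof.
rewrite /xprod; elim: l => [//|a l IH] /=.
rewrite negb_and big_cons monmapM monmap_var.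
by case/orP=> [/negbTE-> | /IH->]; rewrite ?mul0r ?mulr0.
Qed.

(** A monomial as the list of its factors, so that a switch can act on two chosen entries. *)
Definition points m : seq (grid r) :=
  flatten [seq nseq (m i) (enum_val i) | i <- enum 'I_#|{: grid r}|].

Lemma xprod_points m : xprod (points m) = 'X_[m].
Proof.
rewrite mpolyXE_id /xprod /points big_flatten big_map big_enum /=.
apply: eq_bigr => i _.
elim: (m i) => [|k IH]; first by rewrite big_nil expr0.
by rewrite big_cons IH exprS /xvar enum_valK.
Qed.

(** Monomials with a factor outside [S] lie in [P]. The others are grouped by the degree of their
    image, and each is congruent modulo [P] to one representative of its group; since
    [monmap f = 0], the coefficients in each group add up to 0. *)
Lemma monmap_ker (P : polyR F r -> Prop) :
  is_ideal P -> (forall a, a \notin S -> P (xvar F a)) ->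
  (forall l1 l2, all (mem S) l1 -> all (mem S) l2 ->
     (\sum_(a <- l1) mon a)%MM = (\sum_(a <- l2) mon a)%MM ->
     P (xprod l1 - xprod l2)) ->
  forall f, monmap f = 0 -> P f.
Proof.
move=> idP Pvar Pbin f f0; have [P0 [PD PM]] := idP.
pose good m := all (mem S) (points m).
pose deg m := (\sum_(a <- points m) mon a)%MM.
have Xgood m : good m -> monmap 'X_[m] = 'X_[deg m].
  by rewrite -xprod_points => /monmap_xprod.
have Xbad m : ~~ good m -> monmap 'X_[m] = 0 /\ P 'X_[m].
  move=> bad; split; first by rewrite -xprod_points monmap_xprod0.
  case/allPn: bad => a al aS; rewrite -xprod_points /xprod (big_rem a) //=.
  by apply: idealMr => //; apply: Pvar.
have mZ c g : P g -> P (c *: g) by rewrite -mul_mpolyC; apply: PM.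
pose sm := msupp f.
have f0' : \sum_(m <- sm | good m) f@_m *: 'X_[deg m] = 0 :> {mpoly F[M]}.
  transitivity (monmap f) => //; rewrite [in RHS](mpolyE f) (big_morph _ monmapD monmap0).
  rewrite [RHS](bigID good) /= [X in _ + X]big1 ?addr0.
    by apply: eq_bigr => m gm; rewrite monmapZ Xgood.
  by move=> m /Xbad[m0 _]; rewrite monmapZ m0 scaler0.
(* For a good [m] in the support the default is never reached, as [m] itself passes the filter; so
   there [rep m] depends only on [deg m]. *)
pose rep m := head m [seq m' <- sm | good m' && (deg m' == deg m)].
have repP m : m \in sm -> good m -> good (rep m) /\ deg (rep m) = deg m.
  move=> mf gm; rewrite /rep.
  case E: [seq _ <- _ | _] => [|m' l] /=; first by [].
  have: m' \in m' :: l by apply: mem_head.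
  by rewrite -E mem_filter => /andP[/andP[gm' /eqP]].
have repE m1 m2 : m1 \in sm -> good m1 -> deg m1 = deg m2 -> rep m1 = rep m2.
  move=> m1f gm1 e; rewrite /rep e.
  case E: [seq _ <- _ | _] => [|m' l] //=.
  have: m1 \in [::] by rewrite -E mem_filter gm1 e eqxx.
  by [].
have srep : \sum_(m <- sm | good m) f@_m *: 'X_[rep m] = 0 :> polyR F r.
  apply/mpolyP => nu; rewrite mcoeff0 raddf_sum /=.
  have [[m1 [m1f gm1 <-]]|noex] :=
      classic (exists m1, [/\ m1 \in sm, good m1 & rep m1 = nu]); last first.
    rewrite big_seq_cond big1 // => m /andP[mf gm].
    rewrite mcoeffZ mcoeffX; case: eqP => [e|_]; last by rewrite mulr0.
    by case: noex; exists m.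
  (* On good monomials of the support, [rep m = rep m1] exactly when [deg m = deg m1], so the
     coefficient at [nu] equals that of [f0'] at [deg m1]. *)
  have := congr1 (mcoeff (deg m1)) f0'; rewrite mcoeff0; apply: etrans.
  rewrite raddf_sum /=.
  rewrite big_seq_cond [RHS]big_seq_cond; apply: eq_bigr => m /andP[mf gm].
  rewrite !mcoeffZ !mcoeffX; congr (_ * (nat_of_bool _)%:R).
  apply/eqP/eqP => [e|/repE]; last exact.
  by rewrite -(repP m mf gm).2 e (repP m1 m1f gm1).2.
rewrite (mpolyE f) (bigID good) /=; apply: (PD); last first.
  by apply: ideal_sum => // m _ /Xbad[_]; apply: mZ.
rewrite -[X in P X]subr0 -[X in _ - X]srep -sumrB big_seq_cond.
apply: (big_ind P) => // m /andP[mf gm].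
rewrite -scalerBr; apply: mZ; rewrite -!xprod_points.
have [grep drep] := repP m mf gm.
exact: Pbin.
Qed.

Lemma monmap_prime (P : polyR F r -> Prop) :
  is_ideal P -> (forall f, P f <-> monmap f = 0) -> prime_ideal P.
Proof.
move=> idP PE; split=> //; split.
  by rewrite PE monmap1; apply/eqP/oner_neq0.
move=> f g; rewrite !PE monmapM => /eqP.
by rewrite mulf_eq0 => /orP[/eqP|/eqP]; [left|right].
Qed.

End MonomialMap.

(** * Switches and Hamming distance *)

Section Grid.
Variables (n : nat) (r : 'I_n -> nat).
Implicit Types (a b c u v : grid r) (i j : 'I_n).

Lemma swE i a b j : sw i a b j = if j == i then b j else a j.
Proof. by rewrite ffunE. Qed.

Lemma sw_id i a b : a i = b i -> sw i a b = a.
Proof. by move=> e; apply/ffunP => j; rewrite swE; case: eqP => [->|]. Qed.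

Lemma sw_sw i a b u v : sw i (sw i a u) (sw i b v) = sw i a v.
Proof. by apply/ffunP => j; rewrite !swE; case: eqP. Qed.

Lemma sw_swr i a b u : sw i a (sw i b u) = sw i a u.
Proof. by apply/ffunP => j; rewrite !swE; case: eqP. Qed.

Definition dist_off i a b := #|[pred j | (j != i) && (a j != b j)]|.

Lemma distE i a b : dist a b = ((a i != b i) + dist_off i a b)%N.
Proof.
by rewrite /dist (cardD1 i) inE; congr (_ + _)%N.
Qed.

Lemma dist_off_sw i a b u v : dist_off i (sw i a u) (sw i b v) = dist_off i a b.
Proof.
by apply: eq_card => j; rewrite !inE !swE; case: eqP.
Qed.

Lemma dist_off_swr i a b u : dist_off i a (sw i b u) = dist_off i a b.
Proof. by rewrite -{1}(sw_id (erefl (a i))) dist_off_sw. Qed.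

Lemma dist_off0 i a b : dist_off i a b = 0%N -> forall u, sw i a u = sw i b u.
Proof.
move=> /eqP/pred0P off u; apply/ffunP => j; rewrite !swE; case: eqP => // ji.
by have := off j; rewrite inE; case: eqP => //= _ /negbFE/eqP.
Qed.

Lemma distC a b : dist a b = dist b a.
Proof. by apply: eq_card => j; rewrite !inE eq_sym. Qed.

Lemma dist_sw i a b : dist (sw i a b) (sw i b a) = dist a b.
Proof. by rewrite !(distE i) dist_off_sw !swE eqxx eq_sym. Qed.

Lemma dist_sw_le1 i a b : (dist a (sw i a b) <= 1)%N.
Proof.
rewrite (distE i) dist_off_swr.
rewrite [dist_off _ _ _]eq_card0 ?addn0 ?leq_b1 // => j.
by rewrite !inE eqxx andbF.
Qed.

End Grid.

(** * Connected components of switchable sets *)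

Section Components.
Variables (n : nat) (r : 'I_n -> nat) (t : nat) (S : {set grid r}).
Implicit Types (a b c u v : grid r) (i j : 'I_n).

Definition adjS : rel (grid r) :=
  [rel u v | [&& u \in S, v \in S & (dist u v <= 1)%N]].

Lemma connect_adjS_sym : connect_sym adjS.
Proof.
by apply: sym_connect_sym => u v; rewrite /adjS /= distC andbCA.
Qed.

Lemma adj_connected a b : a \in S -> b \in S -> (dist a b <= 1)%N -> connectedIn S a b.
Proof. by move=> aS bS d; rewrite /connectedIn aS bS connect1 //= aS bS. Qed.

Lemma connectedIn_trans a b c :
  connectedIn S a b -> connectedIn S b c -> connectedIn S a c.
Proof.
case/and3P=> aS _ ab /and3P[_ cS bc].
by rewrite /connectedIn aS cS; apply: connect_trans ab bc.
Qed.

Lemma connectedIn_sym a b : connectedIn S a b -> connectedIn S b a.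
Proof.
by case/and3P=> aS bS ab; rewrite /connectedIn aS bS -/adjS connect_adjS_sym.
Qed.

Hypothesis swS : switchable t S.

(** Induction along the path: if [c] follows [a], then [sw i c b] is in [S]. Unless the claim is
    immediate, [a] and [c] differ in one coordinate other than [i], so [a] and [sw i c b] are at
    distance 2 and switching them gives [sw i a b]. *)
Lemma sw_connected i a b : (i < t)%N -> connectedIn S a b -> connectedIn S a (sw i a b).
Proof.
move=> it /and3P[aS bS /connectP[p pth eb]].
suff abS : sw i a b \in S by apply: adj_connected => //; apply: dist_sw_le1.
elim: p a aS pth eb => [|c p IH] a aS /= pth eb; first by rewrite -eb sw_id.
have {pth} /andP[/and3P[_ cS dac] pth] := pth.
have cbS := IH c cS pth eb.
have [off0|off_gt0] := posnP (dist_off i a c); first by rewrite (dist_off0 off0).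
have [ab|ab] := eqVneq (a i) (b i); first by rewrite sw_id.
rewrite -(sw_swr i a c b); apply: (swS aS cbS) => //.
move: dac; rewrite (distE i) => dac.
rewrite (distE i) dist_off_swr swE eqxx ab /=.
by case: (dist_off i a c) off_gt0 dac => [|[|?]] //; case: (_ != _).
Qed.

End Components.

(** * Switch binomials and torsion modulo [It] *)

Section Binomials.
Variables (F : fieldType) (n : nat) (r : 'I_n -> nat) (t : nat).
Implicit Types (a b c u v : grid r) (i j : 'I_n) (S T : {set grid r}).
Local Notation x := (xvar F).
Local Notation It := (@It F n r t).
Local Notation PS := (@PS F n r t).

Lemma fgen0 i a b : a i = b i -> fgen F i a b = 0.
Proof. by move=> e; rewrite /fgen !sw_id // subrr. Qed.

Lemma It_ideal : is_ideal It. Proof. exact: ideal_gen_ideal. Qed.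
Lemma PS_ideal S : is_ideal (PS S). Proof. exact: ideal_gen_ideal. Qed.

Lemma PS_var S a : a \notin S -> PS S (x a).
Proof. by move=> aS; apply: mem_ideal_gen; left; exists a. Qed.

Lemma PS_fgen S i a b : (i < t)%N -> connectedIn S a b -> PS S (fgen F i a b).
Proof. by move=> it ab; apply: mem_ideal_gen; right; exists i, a, b. Qed.

(** If [a] and [b] are in [S], they are connected through [sw i a b]. Otherwise both terms of the
    binomial have a factor outside [S], because switching [sw i a b] and [sw i b a] back returns [a]
    and [b]. *)
Lemma It_sub_PS S : switchable t S -> subI It (PS S).
Proof.
move=> swS; apply: ideal_gen_sub (PS_ideal S) _ => _ [i [a [b [dab it ->]]]].
have [ab|ab] := eqVneq (a i) (b i).
  by rewrite fgen0 //; case: (PS_ideal S).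
have offE : dist_off i b a = 1%N.
  by move: dab; rewrite distC (distE i) eq_sym ab => -[].
have bad c d : ~~ ((c \in S) && (d \in S)) -> PS S (x c * x d).
  have [_ [_ PM]] := PS_ideal S.
  by rewrite negb_and => /orP[/PS_var|/PS_var]; [apply: idealMr; apply: PS_ideal | apply: PM].
have [/andP[aS bS]|nab] := boolP ((a \in S) && (b \in S)).
  apply: PS_fgen => //.
  have abS := swS a b aS bS dab i it.
  apply: (@connectedIn_trans _ _ _ _ (sw i a b)).
    by apply: adj_connected => //; apply: dist_sw_le1.
  apply: adj_connected => //.
  by rewrite distC (distE i) swE !eqxx dist_off_swr offE.
apply: idealB; [exact: PS_ideal|exact: bad|apply: bad].
apply: contra nab => /andP[cS dS].
have dcd : dist (sw i a b) (sw i b a) = 2 by rewrite dist_sw.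
have := swS _ _ cS dS dcd i it; rewrite sw_sw sw_id // => ->.
rewrite distC in dcd.
by have := swS _ _ dS cS dcd i it; rewrite sw_sw sw_id.
Qed.

(** A 2 x 2 minor: the rows are given by the coordinates of [a] and [b] other than [i], the columns
    by the values [u i] and [v i]. *)
Definition minor i a b u v : polyR F r :=
  x (sw i a u) * x (sw i b v) - x (sw i a v) * x (sw i b u).

Lemma fgen_minor i a b : fgen F i a b = minor i a b a b.
Proof. by rewrite /minor (sw_id (erefl (a i))) (sw_id (erefl (b i))). Qed.

Lemma It_minor i a b u v : (i < t)%N -> (dist a b <= 1)%N -> It (minor i a b u v).
Proof.
move=> it; rewrite (distE i) => dab; have [I0 _] := It_ideal.
have [off0|off_gt0] := posnP (dist_off i a b).
  by rewrite /minor !(dist_off0 off0) mulrC subrr.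
have [uv|uv] := eqVneq (u i) (v i).
  have e c : sw i c u = sw i c v.
    by apply/ffunP => j; rewrite !swE; case: eqP => // ->.
  by rewrite /minor !e subrr.
apply: mem_ideal_gen; exists i, (sw i a u), (sw i b v).
split=> //; last by rewrite /fgen !sw_sw.
rewrite (distE i) dist_off_sw !swE eqxx uv.
by move: off_gt0 dab; case: (dist_off i a b) => [|[|?]] //; case: (_ != _).
Qed.

(* The i-th "row" of every vertex c of the path has an entry x c which divides
   the product over T, so proportionality of rows propagates along the path. *)
Lemma connected_minor T i a b :
  (i < t)%N -> connectedIn T a b ->
  exists k, forall u v, It ((\prod_(c in T) x c) ^+ k * minor i a b u v).
Proof.
move=> it /and3P[aT bT /connectP[p pth eb]]; exists (size p).
have [I0 [ID IM]] := It_ideal.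
elim: p a aT pth eb => [|c p IH] a aT /= pth eb u v.
  by rewrite expr0 mul1r eb /minor mulrC subrr.
have {pth} /andP[/and3P[_ cT dac] pth] := pth.
have {}IH := IH c cT pth eb; set X := \prod_(d in T) x d in IH *.
pose Y := \prod_(d in T | d != c) x d.
have XY : X = x c * Y by rewrite /X (bigD1 c).
rewrite exprS {1}XY.
have mac := It_minor u v it dac.
(* Multiplied by [x c], the entry of row [c] in column [c i], the minor of rows [a], [b] becomes a
   combination of minors of rows [c], [b], handled by induction, and of rows [a], [c], which are
   adjacent. *)
have -> : x c * Y * X ^+ size p * minor i a b u v =
    Y * x (sw i a u) * (X ^+ size p * minor i c b c v)
    + Y * x (sw i b c) * X ^+ size p * minor i a c u v
    + Y * x (sw i a v) * (X ^+ size p * minor i c b u c).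
  by rewrite /minor (sw_id (erefl (c i))); ring.
by apply: (ID); [apply: (ID)|]; apply: IM.
Qed.

Lemma connected_fgen T i a b :
  (i < t)%N -> connectedIn T a b ->
  exists k, It ((\prod_(c in T) x c) ^+ k * fgen F i a b).
Proof.
by move=> it /(connected_minor it)[k h]; exists k; rewrite fgen_minor.
Qed.

Lemma It_exp f g k : It (f - g) -> It (f ^+ k - g ^+ k).
Proof. by rewrite subrXX => ?; apply: idealMr It_ideal _. Qed.

Lemma larger_torsion S T :
  max_switchable F t S -> S \proper T ->
  exists s k, ~ PS S s /\ It (s * (\prod_(c in T) x c) ^+ k).
Proof.
move=> [swS maxS]; have [I0 [ID IM]] := It_ideal.
have [m] := ubnP #|~: T|; elim: m T => [//|m IH] T ltm ST.
have [swT|nswT] := classic (switchable t T).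
  have [_ nsub] := maxS T swT ST.
  (* Maximality forbids [PS T] inside [PS S], so a generator of the former escapes the latter; it is
     not a variable, since [T] contains [S]. *)
  have [g [Tg nSg]] : exists g, gensP t T g /\ ~ PS S g.
    apply: NNPP => noex; apply: nsub.
    apply: ideal_gen_sub (PS_ideal S) _ => g Tg.
    by apply: NNPP => nSg; apply: noex; exists g.
  case: Tg nSg => [[a [aT ->]]|[i [a [b [it ab ->]]]] nS].
    case; apply: PS_var; apply: contra aT; apply/subsetP.
    exact: proper_sub.
  have [k Ik] := connected_fgen it ab.
  by exists (fgen F i a b), k; rewrite mulrC.
have [a [b [i [aT bT dab it cT]]]] : exists a b i,
    [/\ a \in T, b \in T, dist a b = 2, (i < t)%N & sw i a b \notin T].
  apply: NNPP => noex; apply: nswT => a b aT bT dab i it.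
  by apply: contraT => cT; case: noex; exists a, b, i.
have [| |s [k [nSs Is]]] := IH (sw i a b |: T).
- rewrite setCU setIC -setDE -ltnS (leq_trans _ ltm) // ltnS.
  by rewrite [X in (_ < X)%N](cardsD1 (sw i a b)) inE cT.
- by apply: proper_sub_trans ST (subsetUr _ _).
(* One [X ^+ k] goes into the torsion relation for the enlarged set; the other two supply
   [(x a * x b) ^+ k], which is traded modulo [It] for a multiple of [x (sw i a b) ^+ k]. *)
exists s, (k + (k + k))%N; split=> //.
rewrite big_setU1 //= in Is; set X := \prod_(c in T) x c in Is *.
pose Y := \prod_(c in T | c != a) x c; pose Z := \prod_(c in T | c != b) x c.
have XY : X = x a * Y by rewrite /X (bigD1 a).
have XZ : X = x b * Z by rewrite /X (bigD1 b).
have Iab : It ((x a * x b) ^+ k - (x (sw i a b) * x (sw i b a)) ^+ k).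
  by apply/It_exp/mem_ideal_gen; exists i, a, b.
have -> : s * X ^+ (k + (k + k)) =
    s * X ^+ k * (Y * Z) ^+ k * ((x a * x b) ^+ k - (x (sw i a b) * x (sw i b a)) ^+ k)
    + (x (sw i b a) * Y * Z) ^+ k * (s * (x (sw i a b) * X) ^+ k).
  by rewrite !exprD {2}XY {2}XZ !exprMn; ring.
by apply: ID; apply: IM.
Qed.

End Binomials.

(** * Primality of [PS] by a monomial parametrization *)

Section Features.
Variables (F : fieldType) (n : nat) (r : 'I_n -> nat) (t : nat) (S : {set grid r}).
Hypothesis swS : switchable t S.
Implicit Types (a b c d : grid r) (i j : 'I_n) (k : option 'I_n) (l : seq (grid r)).
Local Notation x := (xvar F).
Local Notation PS := (@PS F n r t S).

Definition comp a := fingraph.root (adjS S) a.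

(* Each connected component of S is a product A_1 x ... x A_t x B, where B lies
   in the last n - t coordinates.  The features of a point are its component
   paired with its coordinates in these t + 1 factors; a factor is recorded by
   overwriting the other coordinates with those of the root of the component. *)
Definition feat k a : grid r * grid r :=
  if k is Some i then (comp a, if (i < t)%N then sw i (comp a) a else comp a)
  else (comp a, [ffun j : 'I_n => if (j < t)%N then comp a j else a j]).

Lemma connectedIn_comp a b :
  a \in S -> b \in S -> connectedIn S a b = (comp a == comp b).
Proof.
move=> aS bS; rewrite /connectedIn aS bS /=.
by rewrite -(root_connect (connect_adjS_sym S)).
Qed.

Lemma comp_connected a b : connectedIn S a b -> comp a = comp b.
Proof. by move=> /and3P[_ _ ab]; apply/(fingraph.rootP (connect_adjS_sym S)). Qed.

Lemma feat_comp k a b : feat k a = feat k b -> comp a = comp b.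
Proof. by case: k => [i|] []. Qed.

Lemma feat_coord i a b : (i < t)%N -> feat (Some i) a = feat (Some i) b -> a i = b i.
Proof.
move=> it; rewrite /feat it => -[_] /ffunP/(_ i).
by rewrite !swE eqxx.
Qed.

Lemma feat_rest j a b : (t <= j)%N -> feat None a = feat None b -> a j = b j.
Proof. by rewrite leqNgt => /negbTE tj [_] /ffunP/(_ j); rewrite !ffunE tj. Qed.

(** The switch stays in the component of [a], and coordinate [i < t] is seen only by the feature
    [Some i]. *)
Lemma feat_sw i a d k : (i < t)%N -> connectedIn S a d ->
  feat k (sw i a d) = feat k (if k == Some i then d else a).
Proof.
move=> it ad.
have ca := comp_connected (sw_connected swS it ad).
have cd := comp_connected ad.
case: k => [j|] /=; last first.
  rewrite -ca; congr (_, _); apply/ffunP => j; rewrite !ffunE.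
  by case: ltnP => //; case: eqP => // ->; rewrite leqNgt it.
rewrite (inj_eq Some_inj); have [->|ji] := eqVneq j i.
  by rewrite it -ca cd sw_swr.
rewrite -ca; congr (_, _); case: ifP => // _.
apply/ffunP => j'; rewrite !ffunE; case: eqP => // ->.
by rewrite (negbTE ji).
Qed.

Definition same_feats l1 l2 :=
  forall k, perm_eq (map (feat k) l1) (map (feat k) l2).

Lemma same_feats_swap i a d l : (i < t)%N -> connectedIn S a d ->
  same_feats (a :: d :: l) (sw i a d :: sw i d a :: l).
Proof.
move=> it ad k /=; rewrite !feat_sw //; last exact: connectedIn_sym.
by case: eqP => // _; apply/permPl/(perm_catCA [:: _] [:: _]).
Qed.

(** One variable for each pair of a feature index and a value; the exponents of a product then count
    the occurrences of each feature value. *)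
Definition feat_mon a : 'X_{1..#|{: option 'I_n * (grid r * grid r)}|} :=
  [multinom nat_of_bool (feat (enum_val q).1 a == (enum_val q).2) | q < _].

Lemma feat_mon_sum l1 l2 :
  (\sum_(a <- l1) feat_mon a)%MM = (\sum_(a <- l2) feat_mon a)%MM <->
  same_feats l1 l2.
Proof.
have cnt l k v : (\sum_(a <- l) feat_mon a)%MM (enum_rank (k, v)) =
    count_mem v (map (feat k) l).
  rewrite mnm_sumE count_map -sum1_count [RHS]big_mkcond /=.
  by apply: eq_bigr => a _; rewrite mnmE enum_rankK; case: eqP.
split=> [e k|e]; first by apply/allP => v _; rewrite /= -!cnt e.
apply/mnmP => q; rewrite -[q]enum_valK; case: (enum_val q) => k v.
by rewrite !cnt; apply/permP.
Qed.

(** Membership in [S] is asked of the target only; it is what the next rewriting step has to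
    know. *)
Definition sim l1 l2 :=
  [/\ all (mem S) l2, same_feats l1 l2 & PS (xprod F l1 - xprod F l2)].

Lemma sim_trans l1 l2 l3 : sim l1 l2 -> sim l2 l3 -> sim l1 l3.
Proof.
move=> [S2 f12 p12] [S3 f23 p23]; split=> //.
  by move=> k; apply: perm_trans (f12 k) (f23 k).
exact: ideal_trans (PS_ideal F t S) p12 p23.
Qed.

Lemma sim_perm l1 l2 : all (mem S) l1 -> perm_eq l1 l2 -> sim l1 l2.
Proof.
move=> S1 p12; split; first by rewrite -(perm_all _ p12).
  by move=> k; apply: perm_map.
rewrite /xprod (perm_big _ p12) subrr.
by case: (PS_ideal F t S).
Qed.

Lemma sim_swap i a d l : (i < t)%N -> connectedIn S a d -> all (mem S) l ->
  sim (a :: d :: l) (sw i a d :: sw i d a :: l).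
Proof.
move=> it ad lS; have da := connectedIn_sym ad.
have /and3P[_ adS _] := sw_connected swS it ad.
have /and3P[_ daS _] := sw_connected swS it da.
split; [by rewrite /= adS daS|exact: same_feats_swap|].
rewrite /xprod !big_cons !mulrA -mulrBl.
exact: idealMr (PS_ideal F t S) (PS_fgen F it ad).
Qed.

(** Start from an entry sharing with [b] its component and its coordinates from [t] on. Then correct
    the coordinates below [t] one at a time, switching with an entry that has the required value. *)
Lemma bring_front b l : b \in S -> all (mem S) l ->
  (forall k, feat k b \in map (feat k) l) -> exists l', sim l (b :: l').
Proof.
move=> bS lS bl.
have [c [l' [slc cb]]] : exists c l', sim l (c :: l') /\ feat None c = feat None b.
  have /mapP[c cl cb] := bl None.
  exists c, (rem c l); split=> //; apply: sim_perm => //; exact: perm_to_rem.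
suff /(_ n)[c' [l'' [slc' e cb']]] : forall m, exists c' l'', [/\ sim l (c' :: l''),
    feat None c' = feat None b & forall i, (i < t)%N -> (i < m)%N -> c' i = b i].
  exists l''; suff -> : b = c' by [].
  apply/ffunP => j; have [jt|tj] := ltnP j t; first by rewrite cb'.
  exact/esym/(feat_rest tj e).
elim=> [|m [c' [l'' [slc' e cb']]]]; first by exists c, l'.
have [/andP[mn mt]|nm] := boolP ((m < n)%N && (m < t)%N); last first.
  exists c', l''; split=> // i it; rewrite ltnS leq_eqVlt => /predU1P[im|]; last exact: cb'.
  by case/negP: nm; rewrite -im it ltn_ord.
pose i := Ordinal mn.
have step c2 : feat None c2 = feat None c' -> c2 i = b i ->
    (forall j, j != i -> c2 j = c' j) ->
    feat None c2 = feat None b /\ forall j, (j < t)%N -> (j < m.+1)%N -> c2 j = b j.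
  move=> e2 ci cj; split; first by rewrite e2.
  move=> j jt jm; have [->//|ji] := eqVneq j i.
  rewrite cj // cb' // ltn_neqAle -ltnS jm andbT.
  by apply: contra ji => /eqP jm'; apply/eqP/val_inj.
have [S' f' _] := slc'; have /andP[cS lS'] := S'.
(* Earlier switches preserved the features of the list, so the value wanted at [i] is still
   present. *)
have : feat (Some i) b \in map (feat (Some i)) (c' :: l'').
  by rewrite -(perm_mem (f' (Some i))).
case/mapP => d; rewrite inE => /predU1P[->|dl] di.
  have [|//|? ?] := step c' erefl; first exact: esym (feat_coord (i := i) mt di).
  by exists c', l''.
have dS : d \in S by have /allP/(_ _ dl) := lS'.
have cd : connectedIn S c' d.
  by rewrite connectedIn_comp // (feat_comp e) (feat_comp di).
exists (sw i c' d), (sw i d c' :: rem d l'').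
have [| | |? ?] := step (sw i c' d).
- by rewrite (feat_sw (i := i)).
- by rewrite swE eqxx; exact: esym (feat_coord (i := i) mt di).
- by move=> j /negbTE ji; rewrite swE ji.
split=> //; apply: sim_trans slc' _.
have rS : all (mem S) (rem d l'') by apply/allP => a /mem_rem /(allP lS').
apply: sim_trans (sim_swap (i := i) mt cd rS).
by apply: sim_perm => //; rewrite perm_cons perm_to_rem.
Qed.

(** Induction on [l2]: its head is brought to the front of [l1] and the common variable factored
    out. *)
Lemma same_feats_PS l1 l2 : all (mem S) l1 -> all (mem S) l2 ->
  same_feats l1 l2 -> PS (xprod F l1 - xprod F l2).
Proof.
elim: l2 l1 => [|b l2 IH] l1 S1 S2 f12.
  have /perm_size := f12 None; rewrite size_map => /size0nil ->.
  by rewrite subrr; case: (PS_ideal F t S).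
have /andP[bS lS2] := S2.
have [|l' [S' f1' p1']] := bring_front bS S1.
  by move=> k; rewrite (perm_mem (f12 k)) mem_head.
apply: (ideal_trans (PS_ideal F t S) p1').
have /andP[_ lS'] := S'.
have [_ [_ PM]] := PS_ideal F t S.
rewrite /xprod !big_cons -mulrBr; apply/PM/IH => // k.
have := f12 k; rewrite (permPl (f1' k)) /= perm_cons; exact.
Qed.

Lemma PS_ker f : PS f <-> monmap S feat_mon f = 0.
Proof.
split; last first.
  apply: monmap_ker (PS_ideal F t S) _ _ _ => [a|l1 l2 S1 S2 /feat_mon_sum].
    exact: PS_var.
  exact: same_feats_PS.
apply: (@ideal_gen_sub F n r _ (fun f => monmap S feat_mon f = 0)) => {f}.
  split; first exact: monmap0.
  split=> [f g f0 g0|c f f0]; first by rewrite monmapD f0 g0 addr0.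
  by rewrite monmapM f0 mulr0.
move=> f [[a [aS ->]]|[i [a [b [it ab ->]]]]]; first by rewrite monmap_var (negbTE aS).
have pair2 c d : x c * x d = xprod F [:: c; d].
  by rewrite /xprod !big_cons big_nil mulr1.
have [abS _ _] := sim_swap it ab (l := [::]) isT.
have [aS bS _] := and3P ab.
rewrite /fgen !pair2 monmapB !monmap_xprod //=; last by rewrite aS bS.
apply/eqP; rewrite subr_eq0; apply/eqP; congr 'X_[_].
exact/feat_mon_sum/same_feats_swap.
Qed.

Lemma PS_prime : prime_ideal PS.
Proof. exact: monmap_prime (PS_ideal F t S) PS_ker. Qed.

Lemma xvarN a : a \in S -> ~ PS (x a).
Proof.
move=> aS /PS_ker; rewrite monmap_var aS => /(congr1 (mcoeff (feat_mon a))).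
by rewrite mcoeffX eqxx mcoeff0; apply/eqP/oner_neq0.
Qed.

Lemma prod_xvarN : ~ PS (\prod_(a in S) x a).
Proof.
have [_ [P1 PM]] := PS_prime.
apply: (big_ind (fun f => ~ PS f)) => // [f g nf ng /PM[]//|a]; exact: xvarN.
Qed.

End Features.

(** * Minimality of [PS] among the associated primes *)

Theorem theorem4p12 (F : fieldType) (n : nat) (r : 'I_n -> nat)
  (hr : forall i, (0 < r i)%N) (t : nat) (ht1 : (1 <= t)%N) (htn : (t <= n)%N)
  (S : {set grid r}) (hS : @max_switchable F n r t S) :
  @min_assoc_prime F n r (@It F n r t) (@PS F n r t S).
Proof.
have swS := hS.1.
have prP := PS_prime F swS; have [idP [P1 PM]] := prP.
have idI := It_ideal F r t; have [I0 [ID IM]] := idI.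
have nPX k (f : polyR F r) : ~ PS t S f -> ~ PS t S (f ^+ k).
  by move=> nPf Pfk; exact: (nPf (prime_idealX prP Pfk)).
have torsion (f : polyR F r) : gensP t S f -> exists k s, ~ PS t S s /\ It t (s * f ^+ k).
  case=> [[a [aS ->]]|[i [a [b [it ab ->]]]]].
    have Sa : S \proper a |: S by rewrite properUr // sub1set.
    have [s [k [nPs Is]]] := larger_torsion hS Sa.
    exists k, (s * (\prod_(c in S) xvar F c) ^+ k); split.
      by case/PM => //; apply/nPX/prod_xvarN.
    by rewrite -mulrA -exprMn mulrC [_ * xvar F a]mulrC -big_setU1 // mulrC.
  (* For a binomial generator a power of the product over [S] is already a multiplier outside [PS],
     with exponent 1 on the generator. *)
  have [k Ik] := connected_fgen F it ab.
  exists 1%N, ((\prod_(c in S) xvar F c) ^+ k); rewrite expr1; split=> //.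
  exact/nPX/prod_xvarN.
split.
  split=> //.
  pose l := [seq xvar F a | a <- enum (~: S)] ++
    [seq fgen F q.1 q.2.1 q.2.2 | q <- enum [set q : 'I_n * (grid r * grid r) |
       (q.1 < t)%N && connectedIn S q.2.1 q.2.2]].
  have lP f : f \in l <-> gensP t S f.
    rewrite mem_cat; split.
      case/orP=> /mapP[q]; rewrite mem_enum !inE.
        by move=> qS ->; left; exists q.
      by case: q => i [a b] /= /andP[it ab] ->; right; exists i, a, b.
    case=> [[a [aS ->]]|[i [a [b [it ab ->]]]]]; apply/orP; [left|right].
      by apply: map_f; rewrite mem_enum inE.
    by apply/mapP; exists (i, (a, b)); rewrite ?mem_enum ?inE //= it.
  apply: (prime_is_colon (l := l) idI) => //.
  - exact: It_sub_PS.
  - apply: ideal_gen_sub (ideal_gen_ideal _) _ => f /lP fl.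
    exact: mem_ideal_gen.
  - by move=> f /lP /torsion.
(* [Q] is a colon ideal of [It], hence contains it and so every [s * f ^+ k] from [torsion]; as [s]
   is outside [PS], it is outside [Q], and primality puts each generator [f] in [Q]. *)
move=> Q [prQ [h Qh]] QP f; split; first exact: QP.
have [idQ [Q1 QM]] := prQ.
apply: ideal_gen_sub idQ _ f => f /torsion[k [s [nPs Is]]].
have [/QP //|/(prime_idealX prQ) //] : Q s \/ Q (f ^+ k).
by apply: QM; rewrite Qh; apply: idealMr.
Qed.
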